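(* Let $A\in\mathbb{R}^{n\times n}$ be passive, $B\in\mathbb{R}^{n\times q}$, $C\in\mathbb{R}^{1\times n}$. Let $V_k\in\mathbb{R}^{n\times k}$ have orthonormal columns spanning the rational Krylov subspace $\mathcal{K}_k$ generated by $A^*$ and $C^*$ (with $C^*\in\mathcal{K}_k$), and let $T_k=V_k^*AV_k$, $B_k=V_k^*B$, $C_k=CV_k$. Let $\hat v_{k+1}\in\mathbb{R}^n$ and $g_k\in\mathbb{R}^k$ be the vectors in the Arnoldi relation $A^*V_k=V_kT_k^*+\hat v_{k+1}g_k^*$, where $[V_k,\hat v_{k+1}]$ has orthonormal columns, and let $f_k=V_kg_k$. Let $Y_k\ge0$ be the stabilizing solution of $T_k^*Y+YT_k-YB_kB_k^*Y+C_k^*C_k=0$, and let $X_k=V_kY_kV_k^*$. Then the columns of the matrix $\begin{bmatrix} I\\ X_k\end{bmatrix}\in\mathbb{R}^{2n\times n}$ span an invariant subspace of the matrix $$\mathcal{H}_k=\begin{bmatrix}A-f_k\hat v_{k+1}^* & -BB^*\\ -C^*C & -(A-f_k\hat v_{k+1}^* )^*\end{bmatrix},$$ and the spectrum of $T_k^*-Y_kB_kB_k^*$ is a subset of the spectrum of $A^*-X_kBB^*-\hat v_{k+1}f_k^*$.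
   Context: $M^*$ denotes the conjugate transpose. $Y\ge0$ means symmetric positive semidefinite. A matrix is stable if all its eigenvalues lie in the open left half complex plane; $A$ is passive if its field of values $\{x^*Ax/(x^*x): 0\ne x\in\mathbb{C}^n\}$ lies in the open left half plane. If $A$ is passive then $T_k$ is stable and the reduced Riccati equation has a unique positive semidefinite solution $Y_k$ that is stabilizing, i.e. such that $T_k-B_kB_k^*Y_k$ is stable. For shifts $s_2,\dots,s_k$ with positive real part (closed under conjugation), the rational Krylov subspace is $\mathcal{K}_k=\mathrm{range}([C^*,(A^*-s_2I)^{-1}C^*,\dots,\prod_{j=1}^{k-1}(A^*-s_{j+1}I)^{-1}C^*])$, assumed of dimension $k$; an orthonormal basis of it satisfies an Arnoldi relation of the displayed form. *)

(* Defs.v *)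
(* ℝ is an arbitrary [R : realType] and ℂ is [R[i]]. *)
From mathcomp Require Export all_boot all_order all_algebra.
From mathcomp Require Export complex reals.

Set Implicit Arguments.
Unset Strict Implicit.
Unset Printing Implicit Defensive.

Import Order.TTheory GRing.Theory Num.Theory.
Export GRing.Theory Num.Theory.

Local Open Scope ring_scope.
Local Open Scope complex_scope.
Local Open Scope sesquilinear_scope.

(* For a real matrix M the conjugate transpose M^* is the transpose M^T. *)

Notation complexify M := (map_mx (real_complex _) M).

(* [eigenvalue] is the library notion, defined through row eigenvectors; the set
   of eigenvalues of a square matrix is the same for row and column vectors. *)
Definition spectrum (R : rcfType) (n : nat) (M : 'M[R]_n) : pred R[i] :=
  eigenvalue (complexify M).

Definition stable (R : rcfType) (n : nat) (M : 'M[R]_n) : Prop :=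
  forall z : R[i], z \in spectrum M -> complex.Re z < 0.

Definition field_of_values (R : rcfType) (n : nat) (M : 'M[R]_n) (z : R[i]) :
    Prop :=
  exists2 x : 'cV[R[i]]_n, x != 0 &
    z = (x ^t* *m complexify M *m x) 0 0 / (x ^t* *m x) 0 0.

Definition passive (R : rcfType) (n : nat) (M : 'M[R]_n) : Prop :=
  forall z : R[i], field_of_values M z -> complex.Re z < 0.

Definition psd (R : rcfType) (n : nat) (M : 'M[R]_n) : Prop :=
  M^T = M /\ forall x : 'cV[R]_n, 0 <= (x^T *m M *m x) 0 0.

Definition orthonormal_columns (R : rcfType) (m n : nat) (M : 'M[R]_(m, n)) :
    Prop :=
  M^T *m M = 1%:M.

(* MathComp subspaces are row spaces, so column spaces are handled through
   transposes. *)
Definition same_range (F : fieldType) (m n p : nat)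
    (M : 'M[F]_(m, n)) (N : 'M[F]_(m, p)) : Prop :=
  (M^T == N^T)%MS.

(* The column space of S is invariant under x |-> H x. *)
Definition invariant_range (F : fieldType) (m n : nat)
    (H : 'M[F]_m) (S : 'M[F]_(m, n)) : Prop :=
  stablemx S^T H^T.

(* Column j (counted from 0) is
     (M - s_0 I)^-1 ... (M - s_(j-1) I)^-1 b;
   in the usual numbering of shifts s_0, s_1, ... are s_2, s_3, ...
   [invmx] is the true inverse as soon as no s_i is an eigenvalue of M. *)
Definition rational_krylov (F : fieldType) (n k : nat) (M : 'M[F]_n)
    (b : 'cV[F]_n) (s : seq F) : 'M[F]_(n, k) :=
  \matrix_(i < n, j < k)
    ((\big[mulmx/1%:M]_(z <- take j s) invmx (M - z%:M)) *m b) i 0.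

Lemma rational_krylov_generator (F : fieldType) (n k : nat) (M : 'M[F]_n)
    (b : 'cV[F]_n) (s : seq F) :
  (0 < k)%N -> (b^T <= (rational_krylov k M b s)^T)%MS.
Proof.
case: k => // k _; have {1}-> : b = col 0 (rational_krylov k.+1 M b s).
  by apply/colP => i; rewrite 2!mxE take0 big_nil mul1mx.
by rewrite tr_col row_sub.
Qed.

(* Main.v *)
(* With F = A - f v^*, the Arnoldi relation says exactly that F^* V = V T^*, so
   the range of V is invariant under F^* and contains C^*.  Hence the reduced
   Riccati equation, multiplied by V on the left and V^* on the right, becomes a
   Riccati equation for X with coefficient F, which is the invariance of the
   graph of X under H.  Moreover (F^* - X B B^* ) V = V (T^* - Y B_k B_k^* ), so
   V maps eigenvectors to eigenvectors. *)
Require Import Defs.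

Local Open Scope ring_scope.
Local Open Scope complex_scope.

Lemma eigenvalue_trmx (F : fieldType) (n : nat) (M : 'M[F]_n) :
  eigenvalue M^T =1 eigenvalue M.
Proof.
move=> a; rewrite /eigenvalue /eigenspace !kermx_eq0 !row_free_unit.
by rewrite -unitmx_tr linearB /= trmxK tr_scalar_mx.
Qed.

(** A row eigenvector [w] of [S^T] gives the row eigenvector [w *m V^T] of [M^T]. It is nonzero
    because multiplying it by [V] returns [w]. *)
Lemma eigenvalue_intertwine (F : fieldType) (n k : nat)
    (M : 'M[F]_n) (S : 'M[F]_k) (V : 'M[F]_(n, k)) :
  V^T *m V = 1%:M -> M *m V = V *m S ->
  {subset eigenvalue S <= eigenvalue M}.
Proof.
move=> VV MV a; rewrite -!topredE /= -eigenvalue_trmx -(eigenvalue_trmx _ _ M).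
case/eigenvalueP=> w wS w_neq0; apply/eigenvalueP; exists (w *m V^T).
  by rewrite -mulmxA -trmx_mul MV trmx_mul mulmxA wS scalemxAl.
apply: contraNneq w_neq0 => wV0.
by rewrite -[w]mulmx1 -VV mulmxA wV0 mul0mx.
Qed.

Lemma row_proj_id (F : fieldType) (m n k : nat)
    (V : 'M[F]_(n, k)) (C : 'M[F]_(m, n)) :
  V^T *m V = 1%:M -> (C <= V^T)%MS -> C *m V *m V^T = C.
Proof.
by move=> VV /submxP[D ->]; rewrite -[_ *m V]mulmxA VV mulmx1.
Qed.

(** The block matrix sends [col_mx 1%:M X] to [col_mx 1%:M X *m (A - P *m X)]: the upper block is
    immediate, the lower block is the Riccati equation. *)
Lemma riccati_graph_invariant (F : fieldType) (n : nat)
    (A P Q X : 'M[F]_n) :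
  A^T *m X + X *m A - X *m P *m X + Q = 0 ->
  invariant_range (block_mx A (- P) (- Q) (- A^T)) (col_mx 1%:M X).
Proof.
move=> ricc; rewrite /invariant_range -trmx_mul mul_block_col !mulmx1.
have -> : - Q + - A^T *m X = X *m (A + - P *m X).
  apply/eqP; rewrite -subr_eq0 -oppr_eq0 -[X in _ == X]ricc.
  rewrite mulmxDr !mulNmx mulmxN mulmxA !opprD !opprK.
  by rewrite [Q + _]addrC -addrA [Q + _]addrC !addrA.
rewrite -{1}[A + _]mul1mx -mul_col_mx trmx_mul; exact: submxMl.
Qed.

Theorem proposition6p1 (R : realType) (n q k : nat)
    (A : 'M[R]_n) (B : 'M[R]_(n, q)) (C : 'rV[R]_n)
    (s : (k.-1).-tuple R[i]) (V : 'M[R]_(n, k))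
    (v : 'cV[R]_n) (g : 'cV[R]_k) (Y : 'M[R]_k) :
  let K := rational_krylov k (complexify A^T) (complexify C^T) s in
  let T := V^T *m A *m V in
  let Bk := V^T *m B in
  let Ck := C *m V in
  let f := V *m g in
  let X := V *m Y *m V^T in
  let H : 'M[R]_(n + n) :=
    block_mx (A - f *m v^T) (- (B *m B^T))
             (- (C^T *m C)) (- (A - f *m v^T)^T) in
  passive A ->
  (0 < k)%N ->
  {in s, forall z, 0 < complex.Re z} ->
  {in s, forall z, z^* \in s} ->
  \rank K = k ->
  orthonormal_columns V ->
  same_range (complexify V) K ->
  A^T *m V = V *m T^T + v *m g^T ->
  orthonormal_columns (row_mx V v) ->
  psd Y ->
  T^T *m Y + Y *m T - Y *m Bk *m Bk^T *m Y + Ck^T *m Ck = 0 ->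
  stable (T - Bk *m Bk^T *m Y) ->
  invariant_range H (col_mx 1%:M X) /\
  {subset spectrum (T^T - Y *m Bk *m Bk^T)
     <= spectrum (A^T - X *m B *m B^T - v *m f^T)}.
Proof.
move=> K T Bk Ck f X H _ k_gt0 _ _ _ VV VK arnoldi _ _ ricc _.
have CVV : Ck *m V^T = C.
  (* The shifts may be complex, so the range inclusion lives over [R[i]]; the resulting identity
     between real matrices descends by injectivity of the embedding. *)
  have /row_proj_id : (complexify C <= (complexify V)^T)%MS.
    rewrite (eqmxP VK) -[complexify C]trmxK map_trmx.
    exact: rational_krylov_generator.
  rewrite map_trmx -!map_mxM VV map_mx1 => /(_ erefl); exact: map_mx_inj.
have BkE : V^T *m B = Bk by [].
have BkT : B^T *m V = Bk^T by rewrite trmx_mul trmxK.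
set F := A - f *m v^T in H *.
have FtE : F^T = A^T - v *m f^T by rewrite linearB /= trmx_mul trmxK.
clearbody T Bk Ck F.
have FtV : F^T *m V = V *m T^T.
  (* Orthonormality gives [f^T *m V = g^T], so the correction cancels the Arnoldi residual
     [v *m g^T]. *)
  by rewrite FtE mulmxBl arnoldi trmx_mul -!mulmxA VV mulmx1 addrK.
have VtF : V^T *m F = T *m V^T by apply: trmx_inj; rewrite !trmx_mul !trmxK.
split.
  apply: riccati_graph_invariant.
  transitivity (V *m (T^T *m Y + Y *m T - Y *m Bk *m Bk^T *m Y + Ck^T *m Ck)
                  *m V^T); last by rewrite ricc mulmx0 mul0mx.
  rewrite !(mulmxDr V, mulmxDl _ _ V^T) mulmxN mulNmx; congr (_ + _ - _ + _).
  - by rewrite /X !mulmxA FtV.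
  - by rewrite /X -!mulmxA VtF.
  - by rewrite -BkT -BkE /X !mulmxA.
  - by rewrite -CVV trmx_mul trmxK !mulmxA.
rewrite /spectrum; apply: (@eigenvalue_intertwine _ _ _ _ _ (complexify V)).
  by rewrite map_trmx -map_mxM VV map_mx1.
(* Swapping the two subtracted terms exposes [F^T = A^T - v *m f^T]. *)
rewrite -!map_mxM addrAC -FtE mulmxBl mulmxBr FtV.
by rewrite -BkT -BkE /X !mulmxA.
Qed.
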